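(* Let $(\mathfrak g,\omega,E)$ be a finite-dimensional complex para-Kähler $3$-Lie algebra. Then $(\mathfrak g_{\mathbb R},\omega_{\mathbb R},J)$ is a real pseudo-Kähler $3$-Lie algebra, where $\mathfrak g_{\mathbb R}$ is the underlying real $3$-Lie algebra of $\mathfrak g$, $J=iE$, and $\omega_{\mathbb R}=\mathrm{Re}(\omega)$ is the real part of $\omega$.
   Context: A $3$-Lie algebra is a vector space $\mathfrak g$ with a trilinear skew-symmetric bracket satisfying $[x,y,[z,w,v]]=[[x,y,z],w,v]+[z,[x,y,w],v]+[z,w,[x,y,v]]$. A symplectic structure on $\mathfrak g$ is a nondegenerate skew-symmetric bilinear form $\omega$ with $\omega([x,y,z],w)-\omega([y,z,w],x)+\omega([z,w,x],y)-\omega([w,x,y],z)=0$. A product structure on $\mathfrak g$ is a linear map $E:\mathfrak g\to\mathfrak g$ with $E^2=\mathrm{Id}$, $E\neq\pm\mathrm{Id}$ and $E[x,y,z]=[Ex,Ey,Ez]+[Ex,y,z]+[x,Ey,z]+[x,y,Ez]-E[Ex,Ey,z]-E[x,Ey,Ez]-E[Ex,y,Ez]$. A paracomplex structure is a product structure whose $\pm1$-eigenspaces have the same dimension. A para-Kähler $3$-Lie algebra is a triple $(\mathfrak g,\omega,E)$ with $\omega$ symplectic, $E$ paracomplex and $\omega(Ex,Ey)=-\omega(x,y)$ for all $x,y$; it is complex if $\mathfrak g$ is a complex $3$-Lie algebra (all maps and forms being complex (multi)linear). A complex structure on a real $3$-Lie algebra is a linear map $J$ with $J^2=-\mathrm{Id}$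 and $J[x,y,z]=-[Jx,Jy,Jz]+[Jx,y,z]+[x,Jy,z]+[x,y,Jz]+J[Jx,Jy,z]+J[x,Jy,Jz]+J[Jx,y,Jz]$. A real pseudo-Kähler $3$-Lie algebra is a triple $(\mathfrak g,\omega,J)$ with $\mathfrak g$ a real $3$-Lie algebra, $\omega$ a symplectic structure, $J$ a complex structure and $\omega(Jx,Jy)=\omega(x,y)$ for all $x,y\in\mathfrak g$. *)

(* Defs.v *)
From HB Require Import structures.
From mathcomp Require Import all_boot all_order all_algebra.
From mathcomp Require Import complex reals.

Set Implicit Arguments.
Unset Strict Implicit.
Unset Printing Implicit Defensive.

Import Order.TTheory GRing.Theory Num.Theory.
Local Open Scope ring_scope.

(* Maps, brackets and forms are plain functions on a vector space, and their
   (multi)linearity over the ground field is part of each predicate.  In this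
   way the same function can be considered both over R[i] and over R. *)

Section ThreeLieAlgebras.
Context {K : numFieldType} {V : lmodType K}.

Definition bilinear_form (omega : V -> V -> K) : Prop :=
  (forall x, scalar (omega x)) /\ (forall y, scalar (omega^~ y)).

Definition trilinear (br : V -> V -> V -> V) : Prop :=
  [/\ forall y z, linear (fun x => br x y z),
      forall x z, linear (fun y => br x y z)
    & forall x y, linear (fun z => br x y z)].

(* The two adjacent transpositions generate all permutations of 3 arguments. *)
Definition skew_symmetric3 (br : V -> V -> V -> V) : Prop :=
  (forall x y z, br y x z = - br x y z) /\
  (forall x y z, br x z y = - br x y z).

Record is_3Lie (br : V -> V -> V -> V) : Prop := Is3Lie {
  is_3Lie_trilinear : trilinear br;
  is_3Lie_skew : skew_symmetric3 br;
  is_3Lie_fundamental : forall x y z w v,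
    br x y (br z w v) =
      br (br x y z) w v + br z (br x y w) v + br z w (br x y v) }.

Record is_symplectic (br : V -> V -> V -> V) (omega : V -> V -> K) : Prop :=
  IsSymplectic {
  is_symplectic_bilinear : bilinear_form omega;
  is_symplectic_skew : forall x y, omega y x = - omega x y;
  is_symplectic_nondegenerate :
    forall x, (forall y, omega x y = 0) -> x = 0;
  is_symplectic_closed : forall x y z w,
    omega (br x y z) w - omega (br y z w) x
      + omega (br z w x) y - omega (br w x y) z = 0 }.

Record is_product_structure (br : V -> V -> V -> V) (E : V -> V) : Prop :=
  IsProductStructure {
  is_product_linear : linear E;
  is_product_involutive : forall x, E (E x) = x;
  is_product_neq_id : ~ (forall x, E x = x);
  is_product_neq_opp : ~ (forall x, E x = - x);
  is_product_integrable : forall x y z,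
    E (br x y z) =
      br (E x) (E y) (E z) + br (E x) y z + br x (E y) z + br x y (E z)
      - E (br (E x) (E y) z) - E (br x (E y) (E z)) - E (br (E x) y (E z)) }.

Record is_complex_structure (br : V -> V -> V -> V) (J : V -> V) : Prop :=
  IsComplexStructure {
  is_complex_linear : linear J;
  is_complex_square : forall x, J (J x) = - x;
  is_complex_integrable : forall x y z,
    J (br x y z) =
      - br (J x) (J y) (J z) + br (J x) y z + br x (J y) z + br x y (J z)
      + J (br (J x) (J y) z) + J (br x (J y) (J z)) + J (br (J x) y (J z)) }.

End ThreeLieAlgebras.

Section ParaKahler.
Context {K : numFieldType} {V : vectType K}.

(* [linfun E] agrees with [E] because a product structure is linear. *)
Record is_paracomplex_structure (br : V -> V -> V -> V) (E : V -> V) : Prop :=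
  IsParacomplexStructure {
  is_paracomplex_product : is_product_structure br E;
  is_paracomplex_dim :
    \dim (passmx.leigenspace (linfun E) 1) = \dim (passmx.leigenspace (linfun E) (- 1)) }.

Record is_para_Kahler (br : V -> V -> V -> V) (omega : V -> V -> K)
    (E : V -> V) : Prop := IsParaKahler {
  is_para_Kahler_3Lie : is_3Lie br;
  is_para_Kahler_symplectic : is_symplectic br omega;
  is_para_Kahler_paracomplex : is_paracomplex_structure br E;
  is_para_Kahler_compat : forall x y, omega (E x) (E y) = - omega x y }.

End ParaKahler.

Record is_pseudo_Kahler (R : realType) (V : vectType R)
    (br : V -> V -> V -> V) (omega : V -> V -> R) (J : V -> V) : Prop :=
  IsPseudoKahler {
  is_pseudo_Kahler_3Lie : is_3Lie br;
  is_pseudo_Kahler_symplectic : is_symplectic br omega;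
  is_pseudo_Kahler_complex : is_complex_structure br J;
  is_pseudo_Kahler_compat : forall x y, omega (J x) (J y) = omega x y }.

(* The underlying real vector space of a complex one: the same carrier and
   addition, with scalars restricted along R -> R[i]. *)
Definition realification (V : Type) : Type := V.

Section Realification.
Variable R : realType.

Section Lmodule.
Variable V : lmodType R[i].

HB.instance Definition _ := GRing.Zmodule.on (realification V).

Definition realification_scale (a : R) (v : realification V) :
  realification V := a%:C%C *: (v : V).

Fact realification_scaleA a b v :
  realification_scale a (realification_scale b v) =
  realification_scale (a * b) v.
Proof. by rewrite /realification_scale scalerA rmorphM. Qed.

Fact realification_scale1 : left_id 1 realification_scale.
Proof. by move=> v; rewrite /realification_scale rmorph1 scale1r. Qed.

Fact realification_scaleDr : right_distributive realification_scale +%R.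
Proof. by move=> a u v; exact: scalerDr. Qed.

Fact realification_scaleDl v :
  {morph realification_scale^~ v : a b / a + b}.
Proof. by move=> a b; rewrite /realification_scale rmorphD /= scalerDl. Qed.

HB.instance Definition _ := GRing.Zmodule_isLmodule.Build R (realification V)
  realification_scaleA realification_scale1
  realification_scaleDr realification_scaleDl.

End Lmodule.

Section FiniteDimension.
Variable V : vectType R[i].
Import VectorInternalTheory.

Fact realification_vect_iso :
  Vector.axiom (dim V + dim V) (realification V).
Proof.
pose f (v : realification V) : 'rV[R]_(dim V + dim V) :=
  row_mx (map_mx (@complex.Re R) (v2r (v : V))) (map_mx (@complex.Im R) (v2r (v : V))).
pose g (w : 'rV[R]_(dim V + dim V)) : realification V :=
  r2v (\row_j Complex (lsubmx w 0 j) (rsubmx w 0 j)).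
exists f.
  move=> a u v; rewrite /f (_ : v2r _ = a%:C%C *: v2r (u : V) + v2r (v : V));
    last by rewrite -linearP.
  rewrite scale_row_mx add_row_mx; congr row_mx; apply/rowP=> j;
    rewrite !mxE; case: (v2r (u : V) 0 j) => p q; case: (v2r (v : V) 0 j) => s t /=.
    by rewrite mul0r subr0.
  by rewrite mul0r addr0.
exists g => [v|w]; rewrite /f /g.
  rewrite row_mxKl row_mxKr; apply: (canLR (@v2rK _ _)); apply/rowP=> j.
  by rewrite !mxE; case: (v2r (v : V) 0 j).
rewrite r2vK -[RHS]hsubmxK; congr row_mx; apply/rowP=> j; by rewrite !mxE.
Qed.

HB.instance Definition _ :=
  Lmodule_hasFinDim.Build R (realification V) realification_vect_iso.

End FiniteDimension.
End Realification.

(* Main.v *)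
Require Import Defs.
From mathcomp Require Import all_boot all_order all_algebra.
From mathcomp Require Import complex reals.

(** A complex (multi)linear map is in particular real (multi)linear, so the
    identities that make [br] a 3-Lie bracket and [omega] closed carry over to
    the realification, the latter after taking real parts.  The real part of a
    complex bilinear form loses no information, because
    [Im (omega x y) = - Re (omega x ('i *: y))]; this gives nondegeneracy.

    The rest is multiplication by 'i.  In the integrability identity of a
    product structure [E] every term has odd degree in [E].  Replacing [E] by
    [J = 'i *: E] multiplies the terms of degree 1 by 'i and those of degree 3
    by [- 'i], that is, by 'i up to the change of sign which separates
    integrability of a complex structure from integrability of a product
    structure.  In degree 2, [E^2 = Id] becomes [J^2 = - Id], and the
    anti-isometry [omega (E x) (E y) = - omega x y] becomes an isometry. *)

Set Implicit Arguments.
Unset Strict Implicit.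
Unset Printing Implicit Defensive.

Import GRing.Theory.
Local Open Scope ring_scope.

Section RestrictionOfScalars.
Variable R : realType.
Implicit Types V W : lmodType R[i].

Lemma realification_linear V W (f : V -> W) :
  linear f -> linear (f : realification V -> realification W).
Proof. by move=> f_lin a; apply: f_lin. Qed.

Lemma realification_scalar V (f : V -> R[i]) :
  scalar f -> scalar (fun x : realification V => complex.Re (f x)).
Proof.
move=> f_lin a x y.
have -> : f (a *: x + y) = a%:C%C * f x + f y by apply: f_lin.
by case: (f x) (f y) => p q [s t] /=; rewrite mul0r subr0.
Qed.

Lemma realification_3Lie V (br : V -> V -> V -> V) :
  is_3Lie br -> @is_3Lie R (realification V) br.
Proof.
case=> -[lin1 lin2 lin3] skew fundamental; split=> //.
split=> [y z|x z|x y].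
- exact: realification_linear (lin1 y z).
- exact: realification_linear (lin2 x z).
- exact: realification_linear (lin3 x y).
Qed.

(** Skew symmetry and closedness are additive identities in [omega], so they
    pass to the real part.  If [Re (omega x y)] vanishes for all [y], taking
    ['i *: y] for [y] shows that the imaginary part vanishes too. *)
Lemma Re_symplectic V (br : V -> V -> V -> V) (omega : V -> V -> R[i]) :
  Defs.is_symplectic br omega ->
  @Defs.is_symplectic R (realification V) br
    (fun x y => complex.Re (omega x y)).
Proof.
case=> -[linr linl] skew nondeg closed; split.
- split=> [x|y].
  + exact: realification_scalar (linr x).
  + exact: (realification_scalar (linl y)).
- by move=> x y; rewrite skew raddfN.
- move=> x Re0; apply: nondeg => y.
  have := Re0 (('i)%C *: y : V); have := Re0 y.
  have -> : omega x (('i)%C *: y) = ('i)%C * omega x y.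
    exact: GRing.scalable_linear (linr x) _ _.
  case: (omega x y) => p q /= -> /eqP.
  by rewrite mul0r mul1r sub0r oppr_eq0 => /eqP ->.
- by move=> x y z w; rewrite -!(raddfB, raddfD) closed.
Qed.

End RestrictionOfScalars.

Section MultiplicationByI.
Variables (R : realType) (V : lmodType R[i]).
Local Notation i := ('i%C : R[i]).

Lemma scaleii (v : V) : i *: (i *: v) = - v.
Proof. by rewrite scalerA -expr2 sqr_i scaleN1r. Qed.

(** Since [br] and [E] are linear over the complex numbers, all factors 'i can
    be pulled out of each term of the integrability identity for ['i *: E].
    What remains is 'i times the identity for [E]. *)
Lemma i_product_structure (br : V -> V -> V -> V) (E : V -> V) :
  trilinear br -> is_product_structure br E ->
  @is_complex_structure R (realification V) br (fun x => i *: E x).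
Proof.
case=> lin1 lin2 lin3 [E_lin EK _ _ E_int].
have EZ a x : E (a *: x) = a *: E x by apply: GRing.scalable_linear E_lin _ _.
have Z1 a x y z : br (a *: x) y z = a *: br x y z.
  exact: GRing.scalable_linear (lin1 y z) a x.
have Z2 a x y z : br x (a *: y) z = a *: br x y z.
  exact: GRing.scalable_linear (lin2 x z) a y.
have Z3 a x y z : br x y (a *: z) = a *: br x y z.
  exact: GRing.scalable_linear (lin3 x y) a z.
split.
- apply: (@realification_linear R V V) => a x y.
  by rewrite E_lin scalerDr !scalerA mulrC.
- by move=> x; rewrite EZ EK scaleii.
- move=> x y z; rewrite E_int !(Z1, Z2, Z3, EZ).
  by rewrite !scaleii !scalerBr !scalerDr opprK.
Qed.

End MultiplicationByI.

Theorem theorem9p5 (R : realType) (g : vectType R[i])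
    (br : g -> g -> g -> g) (omega : g -> g -> R[i]) (E : g -> g) :
  is_para_Kahler br omega E ->
  @is_pseudo_Kahler R (realification g)
    br (fun x y => complex.Re (omega x y)) (fun x => ('i)%C *: E x).
Proof.
case=> Lie symp [prod _] compat; split.
- exact: realification_3Lie Lie.
- exact: Re_symplectic symp.
- exact: i_product_structure (is_3Lie_trilinear Lie) prod.
- move=> x y; have [linr linl] := is_symplectic_bilinear symp.
  have -> : omega (('i)%C *: E x) (('i)%C *: E y) =
            ('i)%C * (('i)%C * omega (E x) (E y)).
    rewrite (GRing.scalable_linear (linl _) 'i%C (E x)).
    by rewrite (GRing.scalable_linear (linr _) 'i%C (E y)).
  by rewrite compat mulrA -expr2 sqr_i mulrNN mul1r.
Qed.
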